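(* Assume that for each task $q\in\mathcal{Q}$ not all agents are dominating for $q$. Suppose that for each $q\in\mathcal Q$, $i_q^*\in\mathcal A$ is the unique dominating agent for task $q$. Then $\mathcal{NE}(\mathcal G_W)=\{\hat{\mathbf W}\}$ where, for each $q\in\mathcal Q$, $\hat{\mathbf W}=(\hat w_i^q)$ satisfies (1) $\hat w^q_{i_q^*}=1$, and (2) $\hat w_j^q=0$ for all $j\ne i_q^*$. Further, $\mathcal P^*=C(\hat{\mathbf W})$ is the unique solution of the task-partition problem $$\max_{(\mathcal V_1,\dots,\mathcal V_n),\ \mathcal V_i\subseteq\mathcal Q}\ \sum_{i\in\mathcal A}\sum_{q\in\mathcal V_i}f_i(q)\quad\text{subject to}\quad \bigcup_{i\in\mathcal A}\mathcal V_i=\mathcal Q,\quad \mathcal V_i\cap\mathcal V_j=\varnothing\ \text{ for } i\ne j .$$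
   Context: $\mathcal A=\{1,\dots,n\}$ is a finite set of agents and $\mathcal Q=\{1,\dots,m\}$ a finite set of tasks. For each $i\in\mathcal A$, $f_i:\mathcal Q\to\mathbb R_{\ge 0}$ is a given function. Agent $i$ is dominating for task $q$ if $f_i(q)\ge f_j(q)$ for all $j\in\mathcal A$. It is the unique dominating agent for $q$ if it is the only agent with this property. The weight game $\mathcal G_W$ is the strategic form game in which agent $i\in\mathcal A$ chooses a weight vector $\mathbf w_i=(w_i^q)_{q\in\mathcal Q}\in[0,1]^m$. A profile is a matrix $\mathbf W=(w_i^q)\in[0,1]^{n\times m}$. The utility of agent $i$ is $$U_i(\mathbf w_i,\mathbf w_{-i})=\sum_{q\in\mathcal Q}\Big[f_i(q)w_i^q-\max_{j\in\mathcal A\setminus\{i\}}f_j(q)w_j^q\,w_i^q\Big].$$ A profile $(\hat{\mathbf w}_i,\hat{\mathbf w}_{-i})$ is a Nash equilibrium if $U_i(\hat{\mathbf w}_i,\hat{\mathbf w}_{-i})\ge U_i(\mathbf w_i,\hat{\mathbf w}_{-i})$ for all $\mathbf w_i\in[0,1]^m$ and all $i\in\mathcal A$. $\mathcal{NE}(\mathcal G_W)$ denotes the set of Nash equilibria. The map $C:[0,1]^{n\times m}\to(2^{\mathcal Q})^n$ is $C(\mathbf W)=(\mathrm{tsupp}\,\mathbf w_1,\dots,\mathrm{tsupp}\,\mathbf w_n)$, where $\mathrm{tsupp}\,\mathbf w_i=\{q\in\mathcal Q: w_i^q=1\}$. *)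

(* Defs.v *)
From mathcomp Require Import all_boot all_order all_algebra.
From mathcomp Require Import classical_sets reals.

Set Implicit Arguments.
Unset Strict Implicit.
Unset Printing Implicit Defensive.

Import Order.TTheory GRing.Theory Num.Theory.

Local Open Scope ring_scope.

Section Domination.
Variables (R : realType) (n m : nat) (f : 'I_n -> 'I_m -> R).

Definition dominating (i : 'I_n) (q : 'I_m) : Prop :=
  forall j, f j q <= f i q.

Definition unique_dominating (i : 'I_n) (q : 'I_m) : Prop :=
  dominating i q /\ forall j, dominating j q -> j = i.

End Domination.

Section WeightGame.
Variables (R : realType) (n m : nat) (f : 'I_n -> 'I_m -> R).

(* [0,1]^m is [in_cube] at k = 1, and [0,1]^(n x m) is [in_cube] at k = n. *)
Definition in_cube (k : nat) (W : 'M[R]_(k, m)) : Prop :=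
  forall i q, 0 <= W i q <= 1.

(* U_i(w, w_{-i}), where w_{-i} consists of the rows of W other than row i;
   row i of W is not used. All the terms of the maximum are nonnegative for
   nonnegative f and weights in [0,1], so the default value 0 only matters
   when there is no agent other than i. *)
Definition utility (i : 'I_n) (w : 'rV[R]_m) (W : 'M[R]_(n, m)) : R :=
  \sum_(q < m) (f i q * w 0 q -
    \big[Num.max/0]_(j < n | j != i) (f j q * W j q * w 0 q)).

Definition Nash_equilibria : set 'M[R]_(n, m) :=
  [set W | in_cube W /\
     forall (i : 'I_n) (w : 'rV[R]_m), in_cube w ->
       utility i w W <= utility i (row i W) W]%classic.

End WeightGame.

Definition tsupp (R : realType) (m : nat) (w : 'rV[R]_m) : {set 'I_m} :=
  [set q | w 0 q == 1]%SET.

Definition tsupp_family (R : realType) (n m : nat) (W : 'M[R]_(n, m)) :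
    {ffun 'I_n -> {set 'I_m}} :=
  [ffun i => tsupp (row i W)].

Section TaskPartition.
Variables (R : realType) (n m : nat) (f : 'I_n -> 'I_m -> R).

(* The parts are allowed to be empty. *)
Definition task_partition (V : {ffun 'I_n -> {set 'I_m}}) : Prop :=
  (\bigcup_(i < n) V i = [set: 'I_m])%SET /\
  forall i j, i != j -> (V i :&: V j = finset.set0)%SET.

Definition partition_value (V : {ffun 'I_n -> {set 'I_m}}) : R :=
  \sum_(i < n) \sum_(q in V i) f i q.

Definition task_partition_solutions : set {ffun 'I_n -> {set 'I_m}} :=
  [set V | task_partition V /\
     forall V', task_partition V' ->
       partition_value V' <= partition_value V]%classic.

End TaskPartition.

(* Main.v *)
Require Import Defs.
From mathcomp Require Import all_boot all_order all_algebra.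
From mathcomp Require Import classical_sets reals.

Set Implicit Arguments.
Unset Strict Implicit.
Unset Printing Implicit Defensive.

Import Order.TTheory GRing.Theory Num.Theory.

Local Open Scope ring_scope.

(** Since weights are nonnegative, the own weight factors out of the maximum
    ([utilityE]): against fixed opponents, the utility of an agent is linear in
    its own weights, with coefficient at task [q] equal to its marginal gain
    there. So a profile is an equilibrium exactly when every single entry is a
    best response on [0,1] ([Nash_equilibriaP]): it must be 1 where the gain is
    positive and 0 where it is negative. The gain of the unique dominating agent
    is positive whatever the others do ([marginal_dominating_gt0]), which forces
    its weight to be 1; once that weight is 1, the gain of every other agent is
    negative ([marginal_dominated_lt0]), which forces weight 0. The same signs
    show that the resulting profile is an equilibrium.

    A task partition amounts to a function giving each task its owner
    ([task_partitionP]), and its value is the sum over the tasks of the value of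
    the owner ([partition_value_owner]). This sum is maximized one task at a
    time, and only by choosing the dominating agent for every task. *)

(** * Marginal gains and equilibria *)

Section Marginal.
Variables (R : realType) (n m : nat) (f : 'I_n -> 'I_m -> R).
Implicit Types (i j : 'I_n) (q : 'I_m) (W : 'M[R]_(n, m)) (w : 'rV[R]_m).

Definition marginal W i q : R :=
  f i q - \big[Num.max/0]_(j < n | j != i) (f j q * W j q).

Lemma utilityE W i w : in_cube w ->
  utility f i w W = \sum_(q < m) w 0 q * marginal W i q.
Proof.
move=> w01; apply: eq_bigr => q _; have /andP[w_ge0 _] := w01 0 q.
rewrite /marginal mulrBr [f i q * _]mulrC; congr (_ - _).
rewrite [RHS]mulrC.
elim/big_rec2: _ => [|j x y _ ->]; first by rewrite mul0r.
by rewrite maxr_pMl.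
Qed.

Lemma in_cube_row W i : in_cube W -> in_cube (row i W).
Proof. by move=> W01 k q; rewrite mxE. Qed.

(** The cube is a product of intervals, so the linear utility can be maximized
    one coordinate at a time. *)
Lemma Nash_equilibriaP W : Nash_equilibria f W <->
  in_cube W /\ forall i q (x : R), 0 <= x <= 1 ->
    x * marginal W i q <= W i q * marginal W i q.
Proof.
split=> -[W01 best]; split=> //.
  move=> i q x x01.
  pose w : 'rV[R]_m := \row_p (if p == q then x else W i p).
  have w01 : in_cube w by move=> k p; rewrite mxE; case: eqP.
  have := best i w w01.
  rewrite !utilityE //; last exact: in_cube_row.
  rewrite (bigD1 q) //= [leRHS](bigD1 q) //= !mxE eqxx.
  under eq_bigr => p /negPf pq do rewrite mxE pq.
  under [X in _ <= _ + X]eq_bigr => p _ do rewrite mxE.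
  by rewrite lerD2r.
move=> i w w01; rewrite !utilityE //; last exact: in_cube_row.
by apply: ler_sum => q _; rewrite mxE best.
Qed.

Lemma Nash_marginal_gt0 W i q :
  Nash_equilibria f W -> 0 < marginal W i q -> W i q = 1.
Proof.
case/Nash_equilibriaP=> W01 best gain.
have /andP[_ W_le1] := W01 i q.
apply/le_anti; rewrite W_le1 /= -(ler_pM2r gain).
by rewrite best // ler01 lexx.
Qed.

Lemma Nash_marginal_lt0 W i q :
  Nash_equilibria f W -> marginal W i q < 0 -> W i q = 0.
Proof.
case/Nash_equilibriaP=> W01 best gain.
have /andP[W_ge0 _] := W01 i q.
apply/le_anti; rewrite W_ge0 andbT -(ler_nM2r gain).
by rewrite best // lexx ler01.
Qed.

End Marginal.

(** * Task partitions as owner functions *)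

Section Owner.
Variables (R : realType) (n m : nat) (f : 'I_n -> 'I_m -> R).

Definition owner_partition (o : 'I_m -> 'I_n) : {ffun 'I_n -> {set 'I_m}} :=
  [ffun i => [set q | o q == i]]%SET.

Lemma task_partitionP (V : {ffun 'I_n -> {set 'I_m}}) :
  task_partition V <-> exists o, V = owner_partition o.
Proof.
split=> [[covV disjV]|[o ->]]; last first.
  split.
    apply/setP=> q; rewrite finset.in_setT; apply/finset.bigcupP.
    by exists (o q); rewrite // ffunE finset.inE.
  move=> i j ij; apply/setP=> q; rewrite !ffunE !finset.inE.
  by case: (o q =P i) => // ->; rewrite (negPf ij).
have /fin_all_exists[o oV] : forall q, exists i, q \in V i.
  move=> q; have /finset.bigcupP[i _ qi] : q \in (\bigcup_(i < n) V i)%SET.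
    by rewrite covV finset.in_setT.
  by exists i.
exists o; apply/ffunP=> i; apply/setP=> q; rewrite ffunE finset.inE.
have [<-|oq_i] := eqVneq (o q) i; first exact: oV.
have /setP/(_ q) := disjV _ _ oq_i.
by rewrite !finset.inE oV.
Qed.

Lemma partition_value_owner (o : 'I_m -> 'I_n) :
  partition_value f (owner_partition o) = \sum_(q < m) f (o q) q.
Proof.
rewrite /partition_value (exchange_big_dep xpredT) //=.
apply: eq_bigr => q _; rewrite (big_pred1 (o q)) // => i.
by rewrite ffunE finset.inE eq_sym.
Qed.

End Owner.

(** * Unique dominating agents *)

Section UniqueDominating.
Variables (R : realType) (n m : nat) (f : 'I_n -> 'I_m -> R).
Variable istar : 'I_m -> 'I_n.
Hypothesis f_ge0 : forall i q, 0 <= f i q.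
Hypothesis not_all_dominating : forall q, ~ (forall i, dominating f i q).
Hypothesis istar_dominating : forall q, unique_dominating f (istar q) q.
Implicit Types (i j : 'I_n) (q : 'I_m) (W : 'M[R]_(n, m)).

Lemma dominated_lt q j : j != istar q -> f j q < f (istar q) q.
Proof.
have [dom uniq] := istar_dominating q.
move=> j_istar; rewrite lt_neqAle dom andbT; apply: contra j_istar => /eqP fj.
by apply/eqP/uniq => k; rewrite fj.
Qed.

(** If the largest value were 0, all the values would be 0 and every agent would
    be dominating. *)
Lemma dominating_gt0 q : 0 < f (istar q) q.
Proof.
rewrite ltNge; apply/negP => f_le0; apply: (@not_all_dominating q) => i j.
have [dom _] := istar_dominating q.
exact: le_trans (le_trans (dom j) f_le0) (f_ge0 i q).
Qed.

(** The opponents' weights are at most 1, so their contributions stay below the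
    dominating value. *)
Lemma marginal_dominating_gt0 W q :
  in_cube W -> 0 < marginal f W (istar q) q.
Proof.
move=> W01; rewrite subr_gt0; apply: bigmax_lt; first exact: dominating_gt0.
move=> j /dominated_lt; apply: le_lt_trans.
by have /andP[_ W_le1] := W01 j q; rewrite ler_piMr.
Qed.

(** The dominating agent is one of the opponents and contributes its full value
    to the maximum. *)
Lemma marginal_dominated_lt0 W q j :
  W (istar q) q = 1 -> j != istar q -> marginal f W j q < 0.
Proof.
move=> W1 j_istar; rewrite subr_lt0.
apply: lt_le_trans (dominated_lt j_istar) _.
rewrite -[leLHS]mulr1 -W1.
by apply: (le_bigmax_cond _ (fun i => f i q * W i q)); rewrite eq_sym.
Qed.

Definition dominating_profile : 'M[R]_(n, m) :=
  \matrix_(i, q) (i == istar q)%:R.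

Lemma Nash_equilibria_dominating :
  Nash_equilibria f = [set dominating_profile]%classic.
Proof.
apply/seteqP; split=> [W nashW|_ ->].
  have W1 q : W (istar q) q = 1.
    by apply: (Nash_marginal_gt0 nashW); exact: marginal_dominating_gt0 nashW.1.
  apply/matrixP=> i q; rewrite mxE; have [->|i_istar] := eqVneq i (istar q).
    by rewrite W1.
  by apply: (Nash_marginal_lt0 nashW); exact: marginal_dominated_lt0.
have profile01 : in_cube dominating_profile.
  by move=> i q; rewrite mxE; case: eqP => _; rewrite lexx ler01.
apply/Nash_equilibriaP; split=> // i q x /andP[x_ge0 x_le1].
rewrite [dominating_profile i q]mxE.
have [->|i_istar] := eqVneq i (istar q).
  by rewrite ler_wpM2r // ltW // marginal_dominating_gt0.
rewrite mul0r mulr_ge0_le0 // ltW // marginal_dominated_lt0 //.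
by rewrite mxE eqxx.
Qed.

Lemma tsupp_dominating_profile :
  tsupp_family dominating_profile = owner_partition istar.
Proof.
apply/ffunP=> i; apply/setP=> q.
by rewrite !ffunE !finset.inE !mxE pnatr_eq1 eqb1 eq_sym.
Qed.

Lemma task_partition_solutions_dominating :
  task_partition_solutions f = [set owner_partition istar]%classic.
Proof.
have dom q i : f i q <= f (istar q) q by case: (istar_dominating q).
apply/seteqP; split=> [V [/task_partitionP[o ->] optV]|_ ->]; last first.
  split; first by apply/task_partitionP; exists istar.
  move=> _ /task_partitionP[o ->]; rewrite !partition_value_owner.
  exact: ler_sum.
have opt : \sum_(q < m) f (istar q) q <= \sum_(q < m) f (o q) q.
  rewrite -!partition_value_owner; apply: optV.
  by apply/task_partitionP; exists istar.
(* The losses relative to the dominating agents are nonnegative and their sum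
   is at most 0, so each of them vanishes. *)
have loss0 : \sum_(q < m) (f (istar q) q - f (o q) q) == 0.
  rewrite sumrB subr_eq0 eq_le opt /=; exact: ler_sum.
have o_istar q : o q = istar q.
  apply/eqP/negPn/negP => /dominated_lt; rewrite -subr_gt0.
  move: loss0; rewrite psumr_eq0 => [|p _]; last by rewrite subr_ge0.
  by move/allP/(_ q (mem_index_enum q))/eqP => ->; rewrite ltxx.
by apply/ffunP=> i; apply/setP=> q; rewrite !ffunE !finset.inE o_istar.
Qed.

End UniqueDominating.

Theorem mainTheorem4 (R : realType) (n m : nat) (f : 'I_n -> 'I_m -> R)
    (istar : 'I_m -> 'I_n)
    (f_ge0 : forall i q, 0 <= f i q)
    (not_all_dominating : forall q, ~ (forall i, dominating f i q))
    (istar_dominating : forall q, unique_dominating f (istar q) q) :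
  exists What : 'M[R]_(n, m),
    [/\ Nash_equilibria f = [set What]%classic,
        forall q, What (istar q) q = 1,
        forall q j, j != istar q -> What j q = 0
      & task_partition_solutions f = [set tsupp_family What]%classic].
Proof.
exists (dominating_profile R istar); split.
- exact: Nash_equilibria_dominating.
- by move=> q; rewrite mxE eqxx.
- by move=> q j /negPf j_istar; rewrite mxE j_istar.
- by rewrite tsupp_dominating_profile; apply: task_partition_solutions_dominating.
Qed.
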